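(* Let $G$ be a graph which is either unmixed or claw-free. Then for every integer $k\geq 1$, we have $$\deg(J(G)^{(k)})=k\deg(J(G)).$$ In particular, $\deg(J(G)^{(k)})$ is a linear function of $k$.
   Context: Graphs are finite and simple. Let $G$ be a graph with vertex set $V(G)=\{x_1,\ldots,x_n\}$ and edge set $E(G)$, let $\mathbb{K}$ be a field and $S=\mathbb{K}[x_1,\ldots,x_n]$ (vertices are identified with variables). The cover ideal of $G$ is $J(G)=\bigcap_{\{x_i,x_j\}\in E(G)}(x_i,x_j)\subseteq S$. For an integer $k\geq 0$, the $k$th symbolic power of an ideal $I$ of $S$ is $I^{(k)}=\bigcap_{\mathfrak{p}\in \mathrm{Min}(I)}\ker(S\to (S/I^k)_{\mathfrak{p}})$, where $\mathrm{Min}(I)$ is the set of minimal primes of $I$; for the cover ideal this gives $J(G)^{(k)}=\bigcap_{\{x_i,x_j\}\in E(G)}(x_i,x_j)^k$ (an empty intersection being $S$). For a monomial ideal $I$, $\deg(I)$ denotes the maximum degree of the minimal monomial generators of $I$. A subset of $V(G)$ is independent if there are no edges among its vertices; it is a maximal independent subset if it is maximal under inclusion among independent subsets. $G$ is unmixed if all maximal independent subsets of $G$ have the same number of elements. $G$ is claw-free if it has no induced subgraph isomorphic to the claw $K_{1,3}$ (the complete bipartite graph with parts of sizes $1$ and $3$). *)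

(* Defs.v *)
From mathcomp Require Import all_boot all_algebra.
From mathcomp Require Import boolp classical_sets.
From mathcomp Require Export mpoly.

Set Implicit Arguments.
Unset Strict Implicit.
Unset Printing Implicit Defensive.

Import GRing.Theory.
Local Open Scope ring_scope.
Local Open Scope classical_set_scope.

Section Ideals.
Variable R : comNzRingType.
Implicit Types (A I P Q : set R) (k : nat).

Definition ideal_gen A : set R :=
  [set f | exists (r : nat) (c g : 'I_r -> R),
     (forall i, A (g i)) /\ f = \sum_(i < r) c i * g i].

(* For k = 0 the only generator is the empty product 1, so I^0 = R. *)
Definition ideal_pow I k : set R :=
  ideal_gen [set f | exists g : 'I_k -> R,
    (forall i, I (g i)) /\ f = \prod_(i < k) g i].

(* The ideals of ring_quotient are boolean predicates and do not contain 1. *)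
Definition prime_ideal P : Prop :=
  idealr_closed [pred f | f \in P] /\ prime_idealr_closed [pred f | f \in P].

Definition minimal_primes I : set (set R) :=
  [set P | [/\ prime_ideal P, I `<=` P &
     forall Q, prime_ideal Q -> I `<=` Q -> Q `<=` P -> Q = P]].

(* f is in the kernel of R -> (R / I^k)_P iff the class of f in R / I^k is
   killed by some s outside P, i.e. iff s * f is in I^k. *)
Definition symbolic_power I k : set R :=
  \bigcap_(P in minimal_primes I)
    [set f | exists s, ~ P s /\ ideal_pow I k (s * f)].

End Ideals.

Section MonomialIdeals.
Variables (n : nat) (K : fieldType).
Implicit Types (I : set {mpoly K[n]}) (s : seq 'X_{1..n}).

Definition monomial_ideal s : set {mpoly K[n]} :=
  ideal_gen [set f | exists2 m, m \in s & f = 'X_[m]].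

Definition minimal_generators I s : Prop :=
  monomial_ideal s = I /\ forall m, m \in s -> monomial_ideal (rem m s) <> I.

(* A monomial ideal has such a list of generators (Dickson's lemma), and only
   one up to order, so deg does not depend on the choice made by xget. *)
Definition deg I : nat :=
  \max_(m <- xget [::] [set s | minimal_generators I s]) mdeg m.

End MonomialIdeals.

Section Graphs.
Local Close Scope classical_set_scope.
Variables (n : nat) (e : rel 'I_n).
Implicit Types A B : {set 'I_n}.

Definition independent A : bool :=
  [forall x in A, forall y in A, ~~ e x y].

Definition unmixed : Prop :=
  forall A B, maxset independent A -> maxset independent B -> #|A| = #|B|.

Definition complete_bipartite (a b : nat) : rel ('I_a + 'I_b) :=
  fun u v => match u, v with
             | inl _, inr _ | inr _, inl _ => true
             | _, _ => false
             end.

Definition has_induced (T : finType) (h : rel T) : Prop :=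
  exists f : T -> 'I_n, injective f /\ forall u v, e (f u) (f v) = h u v.

Definition claw_free : Prop := ~ has_induced (@complete_bipartite 1 3).

End Graphs.

Definition cover_ideal (n : nat) (K : fieldType) (e : rel 'I_n) :
    set {mpoly K[n]} :=
  [set f | forall i j, e i j -> ideal_gen [set g | g = 'X_i \/ g = 'X_j] f].

Arguments cover_ideal {n} K e.

(* Main.v *)
Require Import Defs.
From mathcomp Require Import all_boot all_algebra.
From mathcomp Require Import zify.
From mathcomp Require boolp classical_sets.

(** The minimal primes of the cover ideal [J] are the ideals [P_ij = (x_i, x_j)] of
    the edges, and [J^(k)] is spanned by the monomials [x^m] that are [k]-covers,
    i.e. satisfy [m i + m j >= k] on every edge ([symbolic_power_coverE]).  One
    inclusion holds because the powers of [P_ij] are primary ([edge_ge_cancel]), the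
    other because the product of the variables off the edge, raised to the power
    [k], multiplies every such monomial into [J^k] ([ideal_pow_off_edge]).  Hence
    the degree of [J^(k)] is the largest degree of a minimal [k]-cover
    ([deg_supp_in]).

    Let [D] be the largest size of a minimal vertex cover, that is, of the
    complement of a maximal independent set.  It remains to show that the largest
    degree of a minimal [k]-cover is [k * D].  The multiple by [k] of a minimal
    vertex cover is a minimal [k]-cover, which gives one inequality
    ([tight_cover_max]).

    For the other inequality, thresholding writes twice a minimal [k]-cover as a sum
    of [k] minimal 2-covers ([tight_cover_level], [sum_levels]), so a bound [2 * D]
    for 2-covers suffices.  Let [Z] and [C] be the sets of vertices on which a
    minimal 2-cover is 0 and 1.  If [T] is a maximal independent subset of [C], then
    the union of [Z] and [T] is a maximal independent set of the graph, and the
    2-cover has degree at most twice the size of its complement provided that [T]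
    contains at most half of [C].  The graph induced on [C] has no isolated vertices,
    and such a [T] exists in it in both cases: in the unmixed case every [T]
    satisfies Hall's condition [#|T| <= #|C :&: nbhd T|] ([card_indep_le_nbhd]), and
    in the claw-free case one builds [T] by deleting closed neighbourhoods of
    suitable vertices ([claw_free_half]). *)

Set Implicit Arguments.
Unset Strict Implicit.
Unset Printing Implicit Defensive.

Ltac card_lia :=
  repeat match goal with |- context [ #|?A| ] => move: #|A| => ? end; clear; lia.

(** * Maximal independent sets with at most half of the vertices *)

Section Combinatorics.
Variables (n : nat) (e : rel 'I_n).
Hypotheses (e_sym : symmetric e) (e_irr : irreflexive e).
Implicit Types (A B C S T M : {set 'I_n}) (x y z u v : 'I_n).

Definition nbhd A : {set 'I_n} := [set y | [exists x in A, e x y]].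

Definition max_indep_in C T :=
  [/\ T \subset C, independent e T & C \subset T :|: nbhd T].

Definition no_isolated C := forall x, x \in C -> exists2 y, y \in C & e x y.

Definition half_indep C := exists2 T, max_indep_in C T & 2 * #|T| <= #|C|.

Lemma nbhdP A y : reflect (exists2 x, x \in A & e x y) (y \in nbhd A).
Proof. by rewrite inE; exact: (iffP exists_inP). Qed.

Lemma indepP A :
  reflect (forall x y, x \in A -> y \in A -> ~~ e x y) (independent e A).
Proof.
apply: (iffP forall_inP) => [h x y xA yA | h x xA].
  exact: (forall_inP (h x xA)).
by apply/forall_inP => y yA; exact: h.
Qed.

Lemma indepU A B : independent e A -> independent e B ->
  (forall x y, x \in A -> y \in B -> ~~ e x y) -> independent e (A :|: B).
Proof.
move=> /indepP iA /indepP iB h; apply/indepP => x y.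
rewrite !inE => /orP[xA|xB] /orP[yA|yB]; [exact: iA | exact: h | | exact: iB].
by rewrite e_sym; exact: h.
Qed.

Lemma indep_sub A B : A \subset B -> independent e B -> independent e A.
Proof.
move=> /fintype.subsetP sAB /indepP iB; apply/indepP => x y xA yA.
by apply: iB; exact: sAB.
Qed.

Lemma indep1 v : independent e [set v].
Proof. by apply/indepP => x y /set1P-> /set1P->; rewrite e_irr. Qed.

Lemma indep0 : independent e set0.
Proof. by apply/indepP => x y; rewrite inE. Qed.

Lemma max_indep_extend C S : S \subset C -> independent e S ->
  exists2 T, max_indep_in C T & S \subset T.
Proof.
move=> sSC iS.
have [|T maxT sST] :=
    @maxset_exists _ (fun A => (A \subset C) && independent e A) S.
  by rewrite sSC.
exists T => //; have /andP[sTC iT] := maxsetp maxT.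
split=> //; apply/fintype.subsetP => x xC; rewrite in_setU.
apply/orP; case: (boolP (x \in nbhd T)) => [|xT]; [by right | left].
suff <-: x |: T = T by rewrite setU11.
apply: (maxsetsup maxT); last exact: subsetUr.
rewrite subUset sub1set xC sTC /=; apply: indepU (indep1 x) iT _.
move=> a y /set1P-> yT; apply: contra xT => exy; apply/nbhdP.
by exists y; rewrite // e_sym.
Qed.

Lemma maxset_indepE A : maxset (independent e) A <-> max_indep_in [set: 'I_n] A.
Proof.
split=> [mA | [_ iA dA]].
  have [T [? iT dT] sAT] := max_indep_extend (subsetT A) (maxsetp mA).
  by rewrite -(maxsetsup mA iT sAT); split; rewrite ?subsetT.
apply/maxsetP; split=> // B iB sAB; apply/eqP; rewrite eqEsubset sAB andbT.
apply/fintype.subsetP => x xB.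
have := fintype.subsetP dA x (in_setT x); rewrite in_setU => /orP[// | /nbhdP[y yA eyx]].
by have /indepP/(_ y x (fintype.subsetP sAB y yA) xB) := iB; rewrite eyx.
Qed.

Section Unmixed.
Variable C : {set 'I_n}.
Hypothesis C_iso : no_isolated C.
Hypothesis C_unm :
  forall T T', max_indep_in C T -> max_indep_in C T' -> #|T| = #|T'|.

(** Exchange argument: [S :\: nbhd M] together with [M] is independent, and what
    a maximal independent [T] has beyond it is not adjacent to [S], since [M]
    already dominates the neighbours of [S].  So that rest can be put back next
    to [S], and equality of cardinals says that [M] is at least as large as the
    part of [S] that it replaced. *)
Lemma card_indep_matched S M : S \subset C -> independent e S ->
  max_indep_in (C :&: nbhd S) M -> #|S :&: nbhd M| <= #|M|.
Proof.
move=> sSC iS [sMN iM dM].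
have sMC : M \subset C by apply: subset_trans sMN (subsetIl _ _).
pose S2 := S :\: nbhd M.
have iMS : independent e (M :|: S2).
  apply: indepU iM (indep_sub (subsetDl _ _) iS) _ => x y xM /setDP[_].
  by apply: contra => exy; apply/nbhdP; exists x.
have sMS : M :|: S2 \subset C.
  by rewrite subUset sMC (subset_trans (subsetDl _ _) sSC).
have [T mT sT] := max_indep_extend sMS iMS; have [sTC iT dT] := mT.
pose U := T :\: (M :|: S2).
have iSU : independent e (S :|: U).
  apply: indepU iS (indep_sub (subsetDl _ _) iT) _ => x y xS /setDP[yT].
  rewrite in_setU negb_or => /andP[yM _]; apply/negP => exy.
  have yN : y \in C :&: nbhd S.
    by rewrite in_setI (fintype.subsetP sTC) //; apply/nbhdP; exists x.
  have := fintype.subsetP dM y yN; rewrite in_setU (negbTE yM) => /nbhdP[z zM ezy].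
  have zT : z \in T by apply: (fintype.subsetP sT); rewrite in_setU zM.
  by have /indepP/(_ z y zT yT) := iT; rewrite ezy.
have sSU : S :|: U \subset C.
  by rewrite subUset sSC (subset_trans (subsetDl _ _) sTC).
have [T' mT' sT'] := max_indep_extend sSU iSU.
have dSU : [disjoint S & U].
  apply/pred0P => x /=; apply/negP => /andP[xS /setDP[xT]].
  rewrite in_setU negb_or in_setD xS andbT negbK => /andP[_ /nbhdP[y yM eyx]].
  have yT : y \in T by apply: (fintype.subsetP sT); rewrite in_setU yM.
  by have /indepP/(_ y x yT xT) := iT; rewrite eyx.
have := subset_leq_card sT'; rewrite -(C_unm mT mT') cardsU.
have /eqP-> : S :&: U == set0 by rewrite setI_eq0.
rewrite cards0 subn0 cardsD (setIidPr sT).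
have := subset_leq_card sT; have := cardsU M S2; have := cardsID (nbhd M) S.
rewrite -/S2; card_lia.
Qed.

(** This is Hall's condition for matching an independent set into its complement.
    A maximal independent [M] inside the neighbourhood of [S] pays for the part
    of [S] that it dominates; the neighbours of the remaining part avoid [M], and
    induction applies to that part. *)
Lemma card_indep_le_nbhd S : S \subset C -> independent e S ->
  #|S| <= #|C :&: nbhd S|.
Proof.
elim: {S}_.+1 {-2}S (ltnSn #|S|) => // m IH S; rewrite ltnS => Sm sSC iS.
have [->|[x xS]] := set_0Vmem S; first by rewrite cards0.
have [M mM _] := max_indep_extend (sub0set (C :&: nbhd S)) indep0.
have [sMN iM dM] := mM.
have S1M := card_indep_matched sSC iS mM.
have S1gt0 : 0 < #|S :&: nbhd M|.
  have [y yC exy] := C_iso (fintype.subsetP sSC x xS).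
  have yN : y \in C :&: nbhd S by rewrite in_setI yC; apply/nbhdP; exists x.
  have [w wM] : exists w, w \in M.
    have := fintype.subsetP dM y yN; rewrite in_setU => /orP[|/nbhdP[w]].
      by exists y.
    by exists w.
  have := fintype.subsetP sMN w wM; rewrite in_setI => /andP[_ /nbhdP[v vS evw]].
  apply/card_gt0P; exists v; rewrite in_setI vS; apply/nbhdP.
  by exists w; rewrite // e_sym.
have cS := cardsID (nbhd M) S.
set S2 := S :\: nbhd M in cS.
have S2S : S2 \subset S by exact: subsetDl.
have IS2 : #|S2| <= #|C :&: nbhd S2|.
  apply: IH; [move: cS S1gt0 Sm; card_lia | exact: subset_trans S2S sSC | exact: indep_sub S2S iS].
have dis : M :&: (C :&: nbhd S2) = set0.
  apply/setP => y; rewrite !in_setI in_set0; apply/negP.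
  case/and3P => yM _ /nbhdP[v /setDP[_ /negP vM] evy]; apply: vM.
  by apply/nbhdP; exists y; rewrite // e_sym.
have : M :|: (C :&: nbhd S2) \subset C :&: nbhd S.
  rewrite subUset sMN setIS //; apply/fintype.subsetP => y /nbhdP[v vS2 evy].
  by apply/nbhdP; exists v => //; exact: (fintype.subsetP S2S).
move/subset_leq_card; rewrite cardsU dis cards0.
move: IS2 cS S1M; card_lia.
Qed.

Lemma unmixed_half : half_indep C.
Proof.
have [T mT _] := max_indep_extend (sub0set C) indep0.
exists T => //; have [sTC iT dT] := mT.
have := card_indep_le_nbhd sTC iT.
have : [disjoint T & C :&: nbhd T].
  apply/pred0P => x /=; rewrite in_setI; apply/negP => /and3P[xT _ /nbhdP[y yT eyx]].
  by have /indepP/(_ y x yT xT) := iT; rewrite eyx.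
rewrite -setI_eq0 => /eqP dis.
have : T :|: (C :&: nbhd T) \subset C by rewrite subUset sTC subsetIl.
move/subset_leq_card; rewrite cardsU dis cards0; card_lia.
Qed.

End Unmixed.

Section ClawFree.

Definition nbrs C v := [set y in C | e v y].
Definition far C v := C :\: (v |: nbrs C v).
(** The vertices that become isolated when [v] and its neighbours are deleted:
    they prevent the induction on [#|C|] from applying to [far C v] directly. *)
Definition stranded C v := [set z in far C v | [forall y in far C v, ~~ e z y]].

Lemma in_far C v x :
  (x \in far C v) = [&& x != v, ~~ e v x & x \in C].
Proof. by rewrite !inE negb_or -andbA; case: (x \in C); rewrite ?andbF ?andbT. Qed.

Lemma strandedP C v z :
  reflect (z \in far C v /\ forall y, y \in far C v -> ~~ e z y)
          (z \in stranded C v).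
Proof.
rewrite [z \in stranded C v]in_set; apply: (iffP andP) => -[zf h]; split=> //.
  by move=> y yf; exact: (forall_inP h).
by apply/forall_inP => y yf; exact: h.
Qed.

(** Take [v], all of [stranded C v], and the set given by induction on what is
    left.  The first two contribute [#|stranded C v| + 1] vertices and use up
    [#|stranded C v| + 1 + #|nbrs C v|], which is at least twice as many. *)
Lemma half_indep_step C v : v \in C -> no_isolated C ->
  #|stranded C v| < #|nbrs C v| ->
  (forall C', #|C'| < #|C| -> no_isolated C' -> half_indep C') ->
  half_indep C.
Proof.
move=> vC isoC ltZN IH.
pose R := far C v :\: stranded C v.
have sZF : stranded C v \subset far C v.
  by apply/fintype.subsetP => z /strandedP[].
have sNC : v |: nbrs C v \subset C.
  rewrite subUset sub1set vC; apply/fintype.subsetP => y.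
  by rewrite inE => /andP[].
have cF : #|far C v| + #|nbrs C v| + 1 = #|C|.
  have := cardsD C (v |: nbrs C v); rewrite -/(far C v) (setIidPr sNC).
  have := subset_leq_card sNC; rewrite cardsU1 inE e_irr andbF /=; card_lia.
have cR : #|R| + #|stranded C v| = #|far C v|.
  have := cardsD (far C v) (stranded C v); rewrite (setIidPr sZF).
  have := subset_leq_card sZF; rewrite -/R; card_lia.
have isoR : no_isolated R.
  move=> x /setDP[xF xZ].
  have [y yF exy] : exists2 y, y \in far C v & e x y.
    have : ~~ [forall y in far C v, ~~ e x y].
      by apply: contra xZ => h; rewrite [x \in stranded C v]in_set xF.
    by case/forall_inPn => y yF; rewrite negbK; exists y.
  exists y => //; apply/setDP; split=> //; apply/negP => /strandedP[_ /(_ x xF)].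
  by rewrite e_sym exy.
have ltRC : #|R| < #|C| by move: cR cF ltZN; card_lia.
have [T' [sT iT dT] cT] := IH R ltRC isoR.
have TF x : x \in T' -> x \in far C v.
  by move/(fintype.subsetP sT)/setDP => [].
have iZT : independent e (stranded C v :|: T').
  apply: indepU => //.
    apply/indepP => x y /strandedP[_ h] /strandedP[yF _]; exact: h.
  by move=> x y /strandedP[_ h] /TF; exact: h.
exists (v |: (stranded C v :|: T')).
  split.
  - rewrite !subUset sub1set vC /=; apply/andP; split; apply/fintype.subsetP => x.
      by move/strandedP => [xF _]; move: xF; rewrite in_far => /and3P[].
    by move/TF; rewrite in_far => /and3P[].
  - apply: indepU (indep1 v) iZT _ => a x /set1P->.
    rewrite in_setU => /orP[/strandedP[xF _] | /TF xF];
    by move: xF; rewrite in_far => /and3P[].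
  - apply/fintype.subsetP => x xC; rewrite in_setU.
    case: (boolP (e v x)) => [evx|nevx].
      by apply/orP; right; apply/nbhdP; exists v; rewrite // setU11.
    case: (eqVneq x v) => [->|xv]; first by rewrite setU11.
    have xF : x \in far C v by rewrite in_far xv nevx.
    case: (boolP (x \in stranded C v)) => [xZ|xZ]; first by rewrite !in_setU xZ orbT.
    have xR : x \in R by apply/setDP.
    have := fintype.subsetP dT x xR; rewrite in_setU => /orP[xT|/nbhdP[y yT eyx]].
      by rewrite !in_setU xT !orbT.
    apply/orP; right; apply/nbhdP; exists y => //.
    by rewrite !in_setU yT !orbT.
have := cardsU1 v (stranded C v :|: T'); have := cardsU (stranded C v) T'.
move: cR cF ltZN cT; card_lia.
Qed.

Hypothesis G_claw : claw_free e.

Lemma claw_freeP u a b c : e u a -> e u b -> e u c ->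
  a != b -> a != c -> b != c -> [|| e a b, e a c | e b c].
Proof.
move=> ua ub uc ab ac bc; apply/negPn/negP; rewrite !negb_or => /and3P[nab nac nbc].
apply: G_claw; exists (fun s : 'I_1 + 'I_3 =>
  match s with inl _ => u | inr i => nth u [:: a; b; c] i end); split.
  have ne x : e u x -> u <> x by move=> ux E; move: ux; rewrite -E e_irr.
  have := ne a ua; have := ne b ub; have := ne c uc.
  move=> uc' ub' ua' [i|i] [j|j].
  - by rewrite (ord1 i) (ord1 j).
  - by case: j => -[|[|[|//]]] ? /=.
  - by case: i => -[|[|[|//]]] ? /= /esym.
  - move=> /= /eqP; rewrite nth_uniq ?ltn_ord //=.
      by move/eqP/val_inj->.
    by rewrite !inE negb_or ab ac bc.
move=> [i|i] [j|j] /=; first exact: e_irr.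
- by case: j => -[|[|[|//]]] ? /=.
- by rewrite e_sym; case: i => -[|[|[|//]]] ? /=.
- by case: i => -[|[|[|//]]] ?; case: j => -[|[|[|//]]] ? //=; rewrite ?e_irr //;
   apply/negbTE; rewrite // e_sym.
Qed.

Lemma stranded_nbrs C v z : z \in stranded C v -> nbrs C z \subset nbrs C v.
Proof.
case/strandedP; rewrite in_far => /and3P[zv nvz zC] h; apply/fintype.subsetP => y.
rewrite !inE => /andP[yC ezy]; rewrite yC /=; apply/negPn/negP => nvy.
have := h y; rewrite in_far yC nvy ezy andbT /=.
case: (eqVneq y v) => [E|_]; last by move/(_ isT).
by rewrite E e_sym (negbTE nvz) in ezy.
Qed.

(** Two such neighbours would form, with [v], a claw centred at [u]. *)
Lemma card_nbr_stranded C v u : u \in nbrs C v ->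
  #|[set z in stranded C v | e u z]| <= 1.
Proof.
rewrite inE => /andP[uC evu]; apply/card_le1_eqP => z z'.
case/setIdP => /strandedP[zF hz] ez /setIdP[/strandedP[zF' _] ez'].
apply/eqP; apply/negPn/negP => zz'.
have nzz' : ~~ e z z' by exact: hz.
move: zF zF'; rewrite !in_far => /and3P[zv nvz _] /and3P[zv' nvz' _].
have : e u v by rewrite e_sym.
move/claw_freeP/(_ ez ez'); rewrite !(eq_sym v) zv zv' (eq_sym z) zz' => /(_ isT isT isT).
by rewrite (negbTE nvz) (negbTE nvz') (negbTE nzz').
Qed.

(** Choose [v] of minimum degree in [C].  A stranded vertex has all its neighbours
    among those of [v], at least as many as [v] has, while each neighbour of [v]
    sees at most one stranded vertex.  Double counting leaves at most one stranded
    vertex, so the inductive step works at [v] unless [v] has degree one and there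
    is a stranded vertex [z].  Then [v] and [z] hang at the same vertex [u]; a third
    neighbour of [u] would give a claw, so these three form a component and the
    step works at [u]. *)
Lemma claw_free_half C : no_isolated C -> half_indep C.
Proof.
elim: {C}_.+1 {-2}C (ltnSn #|C|) => // m IHm C; rewrite ltnS => Cm isoC.
have IH C' : #|C'| < #|C| -> no_isolated C' -> half_indep C'.
  by move=> lt; apply: IHm; exact: leq_trans lt Cm.
have [->|[v0 v0C]] := set_0Vmem C.
  exists set0; last by rewrite cards0.
  by split; rewrite ?sub0set ?indep0.
case: (arg_minnP (fun v => #|nbrs C v|) v0C) => v vC minv.
case: (ltnP #|stranded C v| #|nbrs C v|) => [|leNZ].
  by move/(half_indep_step vC isoC); exact.
have N_gt0 : 0 < #|nbrs C v|.
  by have [y yC vy] := isoC v vC; apply/card_gt0P; exists y; rewrite inE yC.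
have Z_C z : z \in stranded C v -> z \in C.
  by case/strandedP; rewrite in_far => /and3P[].
have le1 : #|stranded C v| * #|nbrs C v| <= #|nbrs C v|.
  rewrite -sum_nat_const -[leqRHS]sum1_card.
  (* count the edges between stranded vertices and neighbours of v *)
  apply: (@leq_trans (\sum_(z in stranded C v) \sum_(u in nbrs C v) e u z)).
    apply: leq_sum => z zZ; apply: leq_trans (minv z (Z_C z zZ)) _.
    rewrite -sum1_card big_mkcond /= [leqRHS]big_mkcond /=; apply: leq_sum => u _.
    case: ifP => // uN; rewrite (fintype.subsetP (stranded_nbrs zZ)) //.
    by move: uN; rewrite inE e_sym => /andP[_ ->].
  rewrite exchange_big /=; apply: leq_sum => u uN.
  rewrite -big_mkcondr /= sum1dep_card.
  exact: card_nbr_stranded.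
have [Z1 N1] : #|stranded C v| = 1 /\ #|nbrs C v| = 1.
  move: le1 N_gt0 leNZ; move: #|stranded C v| #|nbrs C v| => a b; clear; nia.
have /cards1P[u Nu] : #|nbrs C v| == 1 by rewrite N1.
have /cards1P[z Zz] : #|stranded C v| == 1 by rewrite Z1.
have zZ : z \in stranded C v by rewrite Zz set11.
have zN : nbrs C z \subset [set u] by rewrite -Nu stranded_nbrs.
have [uC evu] : u \in C /\ e v u.
  by apply/andP; have := set11 u; rewrite -Nu inE.
have v_nbr y : y \in C -> e v y -> y = u.
  by move=> yC ey; apply/set1P; rewrite -Nu inE yC.
have z_nbr y : y \in C -> e z y -> y = u.
  by move=> yC ey; apply/set1P/(fintype.subsetP zN); rewrite inE yC.
have ezu : e z u.
  by have [y yC ezy] := isoC z (Z_C z zZ); rewrite -(z_nbr y yC ezy).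
have [zv nvz] : z != v /\ ~~ e v z.
  by case/strandedP: zZ; rewrite in_far => /and3P[].
have Nu_sub y : y \in C -> e u y -> y = v \/ y = z.
  move=> yC euy; case: (eqVneq y v) => [|yv]; first by left.
  case: (eqVneq y z) => [|yz]; first by right.
  have yu : y <> u by move=> E; rewrite E e_irr in euy.
  have euv : e u v by rewrite e_sym.
  have euz : e u z by rewrite e_sym.
  have := claw_freeP euv euz euy.
  rewrite !(eq_sym v) zv yv (eq_sym z) yz (negbTE nvz) /= => /(_ isT isT isT) /orP[].
    by move=> evy; case: yu; exact: v_nbr.
  by move=> ezy; case: yu; exact: z_nbr.
apply: (half_indep_step uC isoC _ IH).
suff -> : stranded C u = set0.
  by rewrite cards0; apply/card_gt0P; exists v; apply/setIdP; rewrite e_sym.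
apply/setP => w; rewrite in_set0; apply/negP => /strandedP[].
rewrite in_far => /and3P[wu nuw wC] h.
have [y yC ewy] := isoC w wC.
have := h y; rewrite in_far yC ewy andbT => hy.
have yu : y != u by apply: contra nuw => /eqP <-; rewrite e_sym.
case: (boolP (e u y)) => [euy|neuy]; last by rewrite yu neuy in hy; case/negP: (hy isT).
rewrite e_sym in ewy; case: (Nu_sub y yC euy) => E; rewrite E in ewy.
  by rewrite (v_nbr w wC ewy) eqxx in wu.
by rewrite (z_nbr w wC ewy) eqxx in wu.
Qed.

End ClawFree.

(** * Degrees of minimal covers *)

(** These are the minimal [k]-covers: a positive value cannot be lowered because it
    occurs in an edge of weight exactly [k]. *)
Definition tight_cover k (f : 'I_n -> nat) :=
  (forall i j, e i j -> k <= f i + f j) /\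
  (forall i, 0 < f i -> exists2 j, e i j & f i + f j = k).

Definition max_cover_size := \max_(A | maxset (independent e) A) #|~: A|.

Lemma tight_cover_max A k : maxset (independent e) A ->
  tight_cover k (fun i => k * (i \notin A)).
Proof.
move=> /maxset_indepE[_ /indepP iA dA]; split=> [i j eij | i].
  have : ~~ ((i \in A) && (j \in A)).
    by apply/andP => -[iAi jA]; have := iA i j iAi jA; rewrite eij.
  by rewrite negb_and => /orP[] ->; rewrite muln1 ?leq_addr ?leq_addl.
case: (boolP (i \in A)) => [|iNA _]; first by rewrite muln0.
have := fintype.subsetP dA i (in_setT i); rewrite in_setU (negbTE iNA) => /nbhdP[j jA eji].
by exists j; rewrite 1?e_sym // jA muln0 addn0 muln1.
Qed.

Lemma max_cover_size_attained :
  exists2 A, maxset (independent e) A & #|~: A| = max_cover_size.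
Proof.
have [A0 mA0 _] := max_indep_extend (sub0set [set: 'I_n]) indep0.
have gt0 : 0 < #|[pred A | maxset (independent e) A]|.
  by apply/card_gt0P; exists A0; rewrite inE; apply/maxset_indepE.
have [A mA EA] := eq_bigmax_cond (fun A : {set 'I_n} => #|~: A|) gt0.
by exists A; rewrite ?/max_cover_size ?EA.
Qed.

Lemma tight_cover_le k f i : tight_cover k f -> f i <= k.
Proof.
move=> [_ tf]; case: (posnP (f i)) => [->//|/tf[j _ <-]]; exact: leq_addr.
Qed.

(** In a minimal 2-cover the vertices of value 2 are dominated by the zeros, and no
    zero is adjacent to a vertex of value 1. *)
Lemma max_indep_zeros_ones d T : tight_cover 2 d ->
  max_indep_in [set i | d i == 1] T ->
  max_indep_in [set: 'I_n] ([set i | d i == 0] :|: T).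
Proof.
move=> td [sTC iT dT]; have [cd tt] := td.
have T1 x : x \in T -> d x = 1.
  by move/(fintype.subsetP sTC); rewrite inE => /eqP.
split; first exact: subsetT.
  apply: indepU iT _.
    apply/indepP => x y; rewrite !inE => /eqP dx /eqP dy; apply/negP => /cd.
    by rewrite dx dy.
  move=> x y; rewrite inE => /eqP dx /T1 dy; apply/negP => /cd.
  by rewrite dx dy.
apply/fintype.subsetP => x _; rewrite in_setU.
have := tight_cover_le x td.
case dx : (d x) => [|[|[|//]]] _.
- by rewrite in_setU inE dx.
- have xC : x \in [set i | d i == 1] by rewrite inE dx.
  have := fintype.subsetP dT x xC; rewrite !in_setU => /orP[->|/nbhdP[y yT eyx]].
    by rewrite !orbT.
  by apply/orP; right; apply/nbhdP; exists y; rewrite // in_setU yT orbT.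
- have [|y exy] := tt x; first by rewrite dx.
  rewrite dx => /eqP; rewrite -[X in _ == X]addn0 eqn_add2l => dy.
  by apply/orP; right; apply/nbhdP; exists y; rewrite 1?e_sym // in_setU inE dy.
Qed.

Lemma card_zeros_ones d T : max_indep_in [set i | d i == 1] T ->
  #|[set i | d i == 0] :|: T| = #|[set i | d i == 0]| + #|T|.
Proof.
move=> [/fintype.subsetP sTC _ _]; rewrite cardsU.
suff -> : [set i | d i == 0] :&: T = set0 by rewrite cards0 subn0.
apply/setP => x; rewrite in_setI in_set0; apply/negP => /andP[].
by rewrite inE => /eqP dx /sTC; rewrite inE dx.
Qed.

Hypothesis hG : unmixed e \/ claw_free e.

(** A vertex of value 1 has a tight neighbour, again of value 1.  When the graph is
    unmixed, adding the zeros turns maximal independent sets among the ones into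
    maximal independent sets of the graph, so they all have the same size. *)
Lemma half_indep_ones d : tight_cover 2 d -> half_indep [set i | d i == 1].
Proof.
move=> td; have [cd tt] := td.
have iso : no_isolated [set i | d i == 1].
  move=> x; rewrite inE => /eqP dx; have [|y exy] := tt x; first by rewrite dx.
  by rewrite dx => /(@addnI 1 _ 1) dy; exists y; rewrite // inE dy.
case: hG => [unm|claw]; last exact: claw_free_half.
apply: unmixed_half => // T T' mT mT'.
have /maxset_indepE mZ := max_indep_zeros_ones td mT.
have /maxset_indepE mZ' := max_indep_zeros_ones td mT'.
have := unm _ _ mZ mZ'.
by rewrite !card_zeros_ones // => /addnI.
Qed.

(** Let [Z] be the zeros, [C] the ones and [T] a maximal independent set in [C] with
    at most half of its elements.  The degree of the 2-cover is
    [2 * n - 2 * #|Z| - #|C|], which is at most twice the size of the complement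
    of [Z :|: T]. *)
Lemma tight_cover2_bound d : tight_cover 2 d -> \sum_i d i <= 2 * max_cover_size.
Proof.
move=> td; have [T mT cT] := half_indep_ones td.
pose Z := [set i | d i == 0].
have mZT : maxset (independent e) (Z :|: T).
  by apply/maxset_indepE; exact: max_indep_zeros_ones.
have := @leq_bigmax_cond _ _ (fun A : {set 'I_n} => #|~: A|) _ mZT.
have := cardsC (Z :|: T); rewrite (card_zeros_ones mT) -/Z.
have : \sum_i d i + 2 * #|Z| + #|[set i | d i == 1]| = 2 * #|'I_n|.
  rewrite -!sum1dep_card -sum1_card !big_distrr /= !(big_mkcond (fun i => _ == _)).
  rewrite -!big_split /=; apply: eq_bigr => i _; have := tight_cover_le i td.
  by case: (d i) => [|[|[|]]].
rewrite -/max_cover_size; move: cT; move: (\sum_i _) max_cover_size => s D.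
card_lia.
Qed.

(** The two thresholds [t] and [k - 1 - t] cut a [k]-cover into a 2-cover: if
    [f i <= t] and [i] is adjacent to [j], then [f j >= k - t]. *)
Lemma tight_cover_level k f t : tight_cover k f -> t < k ->
  tight_cover 2 (fun i => (t < f i) + (k <= f i + t)).
Proof.
move=> [cf tf] tk; split=> [i j /cf | i fi].
  lia.
have fi0 : 0 < f i by lia.
have [j eij fij] := tf i fi0; exists j => //; lia.
Qed.

Lemma sum_levels k w : w <= k -> \sum_(t < k) ((t < w) + (k <= w + t)) = 2 * w.
Proof.
have E l : \sum_(t < l) (t < w) = minn w l.
  by elim: l => [|l IH]; rewrite ?big_ord0 ?minn0 // big_ord_recr /= IH; lia.
move=> wk; rewrite big_split /= E (reindex_inj rev_ord_inj) /=.
rewrite (eq_bigr (fun t : 'I_k => nat_of_bool (t < w))); last first.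
  by move=> t _; have := ltn_ord t; lia.
by rewrite E; lia.
Qed.

(** Twice a minimal [k]-cover is the sum of its [k] levels, which are minimal
    2-covers. *)
Lemma tight_cover_bound k f : tight_cover k f -> \sum_i f i <= k * max_cover_size.
Proof.
move=> tf; rewrite -(leq_pmul2l (isT : 0 < 2)) big_distrr /=.
rewrite (eq_bigr (fun i => \sum_(t < k) ((t < f i) + (k <= f i + t)))); last first.
  by move=> i _; rewrite sum_levels // (tight_cover_le i tf).
rewrite exchange_big mulnCA -[k in k * _]card_ord -sum_nat_const /=.
apply: leq_sum => t _; apply: tight_cover2_bound.
exact: tight_cover_level tf (ltn_ord t).
Qed.

End Combinatorics.

(** * Monomial ideals and their generators *)

Import boolp classical_sets.
Import GRing.Theory.

Section IdealGen.
Local Open Scope ring_scope.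
Variables (R : comNzRingType) (A : set R).
Implicit Types (f g c : R).

Lemma ideal_gen_mem g : A g -> ideal_gen A g.
Proof.
by move=> Ag; exists 1%N, (fun=> 1), (fun=> g); rewrite big_ord1 mul1r.
Qed.

Lemma ideal_genD f g : ideal_gen A f -> ideal_gen A g -> ideal_gen A (f + g).
Proof.
move=> [r [c [u [Au ->]]]] [r' [c' [u' [Au' ->]]]].
exists (r + r')%N, (fun i => match split i with inl j => c j | inr j => c' j end),
  (fun i => match split i with inl j => u j | inr j => u' j end); split.
  by move=> i; case: (split i).
by rewrite big_split_ord; congr (_ + _); apply: eq_bigr => i _;
  rewrite ?(unsplitK (inl _ i)) ?(unsplitK (inr _ i)).
Qed.

Lemma ideal_genM c f : ideal_gen A f -> ideal_gen A (c * f).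
Proof.
move=> [r [d [g [Ag ->]]]]; exists r, (fun i => c * d i), g; split=> //.
by rewrite mulr_sumr; apply: eq_bigr => i _; rewrite mulrA.
Qed.

Lemma ideal_gen0 : ideal_gen A 0.
Proof. by exists 0%N, (fun=> 0), (fun=> 0); split=> [[]|]; rewrite ?big_ord0. Qed.

Lemma ideal_gen_ind (P : R -> Prop) : P 0 ->
  (forall f g, P f -> P g -> P (f + g)) -> (forall c g, A g -> P (c * g)) ->
  forall f, ideal_gen A f -> P f.
Proof.
move=> P0 PD PM f [r [c [g [Ag ->]]]].
by apply: big_ind => // i _; exact: PM.
Qed.

End IdealGen.

Section MonomialIdeals.
Local Open Scope ring_scope.
Variables (n : nat) (K : fieldType).
Implicit Types (U V W : pred 'X_{1..n}) (f g : {mpoly K[n]}) (m : 'X_{1..n}).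

Lemma ideal_gen_monomials (A : set {mpoly K[n]}) f :
  (forall m, m \in msupp f -> ideal_gen A 'X_[m]) -> ideal_gen A f.
Proof.
move=> h; rewrite [f]mpolyE big_seq.
apply: big_ind => [|g g' |m mf]; [exact: ideal_gen0 | exact: ideal_genD |].
by rewrite -mul_mpolyC; apply: ideal_genM; exact: h.
Qed.

Definition supp_in U : set {mpoly K[n]} :=
  [set f | forall m, m \in msupp f -> U m]%classic.

Definition up_closed U := forall m m', U m -> (m <= m')%MM -> U m'.

Definition minimal_in U m := U m /\ forall m', U m' -> (m' <= m)%MM -> m' = m.

Lemma supp_in0 U : supp_in U 0.
Proof. by move=> m; rewrite msupp0. Qed.

Lemma supp_inD U f g : supp_in U f -> supp_in U g -> supp_in U (f + g).
Proof.
by move=> Uf Ug m /msuppD_le; rewrite mem_cat => /orP[/Uf|/Ug].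
Qed.

Lemma supp_inX U m : supp_in U 'X_[m] <-> U m.
Proof.
split=> [h | Um m']; first by apply: h; rewrite msuppX mem_head.
by rewrite msuppX inE => /eqP->.
Qed.

Lemma supp_inM U V W f g : (forall m m', U m -> V m' -> W (m + m')%MM) ->
  supp_in U f -> supp_in V g -> supp_in W (f * g).
Proof.
move=> h Uf Vg m /msuppM_le /allpairsP[[m1 m2] /= [m1f m2g ->]].
by apply: h; [exact: Uf | exact: Vg].
Qed.

Lemma monomial_idealE (s : seq 'X_{1..n}) :
  @monomial_ideal n K s = supp_in (fun m => has (fun q => (q <= m)%MM) s).
Proof.
rewrite predeqE => f; split=> [|h].
  apply: ideal_gen_ind => [|f1 f2|c g [m ms ->]]; [exact: supp_in0 | exact: supp_inD |].
  apply: (@supp_inM predT (pred1 m)) => // [m1 m2 _ /eqP->|].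
    by apply/hasP; exists m; rewrite ?lem_addl.
  by apply/supp_inX => /=.
apply: ideal_gen_monomials => m /h /hasP[g gs gm].
rewrite -(submK gm) mpolyXD; apply: ideal_genM; apply: ideal_gen_mem.
by exists g.
Qed.

Lemma minimal_generatorsP U s m : up_closed U ->
  minimal_generators (supp_in U) s -> m \in s <-> minimal_in U m.
Proof.
move=> upU [Es irr].
have UE m' : U m' <-> exists2 q, q \in s & (q <= m')%MM.
  have -> : U m' <-> @monomial_ideal n K s 'X_[m'] by rewrite Es; split=> /supp_inX.
  rewrite monomial_idealE supp_inX; split=> /hasP //.
split=> [ms | [/UE[g gs gm] minm]]; last first.
  by rewrite -(minm g) //; apply/UE; exists g => //; exact: lepm_refl.
split; first by apply/UE; exists m => //; exact: lepm_refl.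
move=> m' /UE[g gs gm'] m'm; apply: contrapT => neq; apply: (irr m ms).
have gm : (g <= m)%MM by exact: lepm_trans gm' m'm.
have gNm : g != m.
  apply/eqP => E; apply: neq; apply/mnmP => i; apply/eqP.
  rewrite eqn_leq (mnm_lepP m'm i).
  by rewrite -E in m'm *; rewrite (mnm_lepP gm' i).
rewrite -Es !monomial_idealE predeqE => f.
split=> h p /h /hasP[q qs qp]; apply/hasP.
  by exists q => //; exact: mem_rem qs.
case: (eqVneq q m) => [E|qm].
  exists g; last by apply: lepm_trans gm _; rewrite -E.
  by move: gs; rewrite (perm_mem (perm_to_rem ms)) inE (negbTE gNm).
by exists q => //; move: qs; rewrite (perm_mem (perm_to_rem ms)) inE (negbTE qm).
Qed.

Lemma mdeg_lt m m' : (m <= m')%MM -> m <> m' -> (mdeg m < mdeg m')%N.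
Proof.
move=> le neq; rewrite -(submK le) mdegD -[X in (X < _)%N]add0n ltn_add2r lt0n.
rewrite mdeg_eq0; apply/eqP => E; apply: neq.
by rewrite -[RHS](submK le) E add0m.
Qed.

Lemma minimal_below U m : U m -> exists2 m', minimal_in U m' & (m' <= m)%MM.
Proof.
elim: {m}_.+1 {-2}m (ltnSn (mdeg m)) => // d IH m; rewrite ltnS => md Um.
have [minm|] := pselect (minimal_in U m).
  by exists m => //; exact: lepm_refl.
move=> nmin; have [m' [Um' lm' neq]] :
    exists m', [/\ U m', (m' <= m)%MM & m' <> m].
  apply: contrapT => nex; apply: nmin; split=> // m' Um' lm'.
  by apply: contrapT => neq; apply: nex; exists m'.
have [|q minq lq] := IH m' _ Um'; first exact: leq_trans (mdeg_lt lm' neq) md.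
by exists q => //; exact: lepm_trans lq lm'.
Qed.

(** A bound on the degrees of the minimal elements makes them finite in number, so
    they can be listed, and the list is a minimal system of generators. *)
Lemma deg_supp_in U D : up_closed U ->
  (forall m, minimal_in U m -> (mdeg m <= D)%N) ->
  (exists2 m, minimal_in U m & mdeg m = D) ->
  deg (supp_in U) = D.
Proof.
move=> upU leD [m0 min0 deg0].
pose b := [seq bmnm q | q : 'X_{1..n < D.+1} <- enum {: 'X_{1..n < D.+1}} & `[< minimal_in U (bmnm q) >]].
have bE m : m \in b <-> minimal_in U m.
  split=> [/mapP[q] | minm].
    by rewrite mem_filter => /andP[/asboolP h _] ->.
  have md : (mdeg m < D.+1)%N by rewrite ltnS leD.
  apply/mapP; exists (BMultinom md) => //.
  by rewrite mem_filter mem_enum andbT; apply/asboolP.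
have b_uniq : uniq b.
  by rewrite map_inj_uniq => [|q q' /val_inj //]; rewrite filter_uniq ?enum_uniq.
have mingen : exists s, minimal_generators (supp_in U) s.
  exists b; split=> [|m mb].
    rewrite monomial_idealE predeqE => f; split=> h m /h.
      by case/hasP => g /bE[Ug _]; exact: upU.
    by case/minimal_below => q /bE qb qm; apply/hasP; exists q.
  move/(congr1 (fun I => I 'X_[m])); have [Um minm] := (bE m).1 mb.
  rewrite monomial_idealE => E.
  have : supp_in U 'X_[m] by apply/supp_inX.
  rewrite -E => /supp_inX /hasP[g]; rewrite mem_rem_uniq // inE => /andP[gm gb] lgm.
  by case/bE: gb => Ug _; rewrite (minm g Ug lgm) eqxx in gm.
rewrite /deg; have := xgetPex [::] mingen; set s := xget _ _ => hs.
apply/eqP; rewrite eqn_leq; apply/andP; split.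
  apply/bigmax_leqP_seq => m ms _; apply: leD.
  by apply/(minimal_generatorsP _ upU hs).
rewrite -deg0; apply: leq_bigmax_seq => //.
by apply/(minimal_generatorsP _ upU hs).
Qed.

End MonomialIdeals.

Arguments supp_in {n} K U.

(** * The primes generated by the ends of an edge *)

Section EdgePrimes.
Local Open Scope ring_scope.
Variables (n : nat) (K : fieldType).
Implicit Types (f g s : {mpoly K[n]}) (m : 'X_{1..n}) (i j : 'I_n).

Lemma coef_cancel_low (R : idomainType) (p q : {poly R}) k : p`_0 != 0 ->
  (forall c, (c < k)%N -> (p * q)`_c = 0) -> forall c, (c < k)%N -> q`_c = 0.
Proof.
move=> p0 pq0; elim/ltn_ind => c IH ck.
have := pq0 c ck; rewrite coefM big_ord_recl /= subn0.
rewrite big1 => [|i _]; last by rewrite IH ?mulr0 //= /bump; have := ltn_ord i; lia.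
by rewrite addr0 => /eqP; rewrite mulf_eq0 (negbTE p0) => /eqP.
Qed.

Definition edge_prime i j : set {mpoly K[n]} :=
  ideal_gen [set g | g = 'X_i \/ g = 'X_j]%classic.

Definition edge_ge i j k : pred 'X_{1..n} := fun m => (k <= m i + m j)%N.

Lemma edge_primeE i j : edge_prime i j = supp_in K (edge_ge i j 1).
Proof.
rewrite predeqE => f; split=> [|h].
  apply: ideal_gen_ind => [|f1 f2|c g gE]; [exact: supp_in0 | exact: supp_inD |].
  apply: (@supp_inM _ _ predT (edge_ge i j 1)) => // [m1 m2 _|].
    rewrite /edge_ge !mnmDE; lia.
  by case: gE => ->; apply/supp_inX; rewrite /edge_ge !mnm1E eqxx ?addn1.
apply: ideal_gen_monomials => m /h; rewrite /edge_ge addn_gt0 => mij.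
have [l lE ml] : exists2 l, l = i \/ l = j & (0 < m l)%N.
  by case/orP: mij => ml; [exists i | exists j]; tauto.
have lm : (U_(l) <= m)%MM.
  by apply/mnm_lepP => l'; rewrite mnm1E; case: eqP => // <-.
rewrite -(submK lm) mpolyXD; apply: ideal_genM; apply: ideal_gen_mem.
by case: lE => ->; [left | right].
Qed.

(** The substitution of [t * 'X_i] for ['X_i] and [t * 'X_j] for ['X_j]; it records
    the degree in these two variables as the degree in [t]. *)
Definition edge_grade i j : {mpoly K[n]} -> {poly {mpoly K[n]}} :=
  mmap (@polyC {mpoly K[n]} \o @mpolyC n K)
       (fun l => ('X_l)%:P * 'X^((l == i) + (l == j))).

Lemma edge_gradeM i j f g :
  edge_grade i j (f * g) = edge_grade i j f * edge_grade i j g.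
Proof. exact: rmorphM. Qed.

Lemma coef_edge_grade i j f c m :
  ((edge_grade i j f)`_c)@_m = if (m i + m j == c)%N then f@_m else 0.
Proof.
have monE p : mmap1 (fun l => ('X_l : {mpoly K[n]})%:P * 'X^((l == i) + (l == j))) p
    = ('X_[p])%:P * 'X^(p i + p j).
  rewrite /mmap1 (eq_bigr (fun l : 'I_n => ('X_l ^+ p l)%:P *
      'X^(((l == i) + (l == j)) * p l))); last first.
    by move=> l _; rewrite exprMn polyC_exp -exprM.
  rewrite big_split /= -rmorph_prod -mpolyXE_id; congr (_ * _).
  rewrite -(big_morph _ (exprD _) (expr0 _)); congr ('X^_).
  under eq_bigr do rewrite mulnDl; rewrite big_split /=.
  have pick k : (\sum_(l < n) (l == k) * p l = p k)%N.
    by rewrite (bigD1 k) //= eqxx mul1n big1 ?addn0 // => l /negbTE->.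
  by rewrite !pick.
rewrite /edge_grade /mmap coef_sum raddf_sum /=.
rewrite (eq_bigr (fun p => (f@_p * (p == m)%:R) * (m i + m j == c)%N%:R)).
  rewrite -mulr_suml.
  have <- : f@_m = \sum_(p <- msupp f) f@_p * (p == m)%:R.
    rewrite {1}[f]mpolyE raddf_sum /=; apply: eq_bigr => p _.
    by rewrite mcoeffZ mcoeffX.
  by case: eqP; rewrite ?mulr1 ?mulr0.
move=> p _; rewrite monE mulrA -polyCM coefCM coefXn mul_mpolyC.
case: (eqVneq p m) => [->|pm].
  rewrite [c == _]eq_sym; case: eqP => _; rewrite ?mulr1 ?mulr0 ?mcoeff0 //.
  by rewrite mcoeffZ mcoeffX eqxx mulr1.
rewrite mulr0 mul0r; case: eqP => _; rewrite ?mulr1 ?mulr0 ?mcoeff0 //.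
by rewrite mcoeffZ mcoeffX (negbTE pm) mulr0.
Qed.

Lemma edge_geP i j k f :
  supp_in K (edge_ge i j k) f <-> forall c, (c < k)%N -> (edge_grade i j f)`_c = 0.
Proof.
split=> [h c ck | h m mf].
  apply/mpolyP => m; rewrite coef_edge_grade mcoeff0; case: eqP => // mc.
  apply/eqP; rewrite mcoeff_eq0; apply/negP => /h; rewrite /edge_ge mc.
  by rewrite leqNgt ck.
rewrite /edge_ge leqNgt; apply/negP => /h /(congr1 (mcoeff m)).
rewrite coef_edge_grade eqxx mcoeff0 => /eqP; rewrite mcoeff_eq0.
by rewrite mf.
Qed.

(** The powers of an edge prime are primary.  The graded image of [s] has a nonzero
    constant coefficient, and the coefficients lie in an integral domain, so
    multiplication by [s] preserves the order of vanishing in [t]. *)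
Lemma edge_ge_cancel i j k s f : ~ edge_prime i j s ->
  supp_in K (edge_ge i j k) (s * f) -> supp_in K (edge_ge i j k) f.
Proof.
move=> sP /edge_geP sf; apply/edge_geP; apply: coef_cancel_low.
  apply/eqP => s0; apply: sP; rewrite edge_primeE; apply/edge_geP => c.
  by rewrite ltnS leqn0 => /eqP->; exact: s0.
by move=> c ck; rewrite -edge_gradeM sf.
Qed.

Lemma edge_prime_prime i j : prime_ideal (edge_prime i j).
Proof.
have memE u : (u \in [pred f | f \in edge_prime i j]) = edge_prime i j u :> Prop.
  by rewrite -topredE /= in_setE.
have ltE m : edge_ge i j 1 m -> forall m', edge_ge i j 1 (m' + m)%MM.
  by move=> + m'; rewrite /edge_ge !mnmDE; lia.
split; first split.
- by rewrite memE edge_primeE; exact: supp_in0.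
- apply/negP; rewrite memE edge_primeE => /(_ 0%MM).
  by rewrite msupp1 mem_head /edge_ge !mnm0E => /(_ isT).
- move=> a u v; rewrite !memE => uP vP; apply: ideal_genD vP.
  exact: ideal_genM.
move=> u v; rewrite memE => uv; apply/orP; rewrite !memE.
have [|uP] := pselect (edge_prime i j u); [by left | right].
by move: uv; rewrite !edge_primeE; exact: edge_ge_cancel.
Qed.

End EdgePrimes.

Arguments edge_prime {n} K i j.

(** * Symbolic powers of the cover ideal *)

Section SymbolicPowers.
Local Open Scope ring_scope.
Local Open Scope classical_set_scope.
Variables (n : nat) (K : fieldType) (e : rel 'I_n).
Hypothesis e_irr : irreflexive e.
Implicit Types (f g s : {mpoly K[n]}) (m : 'X_{1..n}) (i j : 'I_n).

Definition k_cover k : pred 'X_{1..n} :=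
  fun m => [forall i, forall j, e i j ==> (k <= m i + m j)%N].

Lemma k_coverP k m :
  reflect (forall i j, e i j -> (k <= m i + m j)%N) (k_cover k m).
Proof.
apply: (iffP forallP) => [h i j | h i]; first exact: (implyP (forallP (h i) j)).
by apply/forallP => j; apply/implyP; exact: h.
Qed.

Lemma cover_idealE : cover_ideal K e = supp_in K (k_cover 1).
Proof.
rewrite predeqE => f; split=> [h m mf | h i j eij].
  apply/k_coverP => i j /h; rewrite -/(edge_prime K i j) edge_primeE; exact.
rewrite -/(edge_prime K i j) edge_primeE => m /h /k_coverP; exact.
Qed.

(** Otherwise the variables outside [Q] form a vertex cover; their product lies in
    the cover ideal, hence in [Q], although no factor does. *)
Lemma prime_contains_edge (Q : set {mpoly K[n]}) : prime_ideal Q ->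
  cover_ideal K e `<=` Q -> exists i j, e i j /\ edge_prime K i j `<=` Q.
Proof.
have memE u : (u \in [pred f | f \in Q]) = Q u :> Prop.
  by rewrite -topredE /= in_setE.
move=> [[Q0 Q1 QD] QM] JQ; rewrite memE in Q0; move/negP: Q1; rewrite memE => Q1.
have [i [j [eij Qi Qj]]] : exists i j, [/\ e i j, Q 'X_i & Q 'X_j].
  apply: contrapT => nex.
  pose m := [multinom (~~ `[< Q 'X_i >] : nat) | i < n].
  have : Q 'X_[m].
    apply: JQ; rewrite cover_idealE; apply/supp_inX/k_coverP => i j eij.
    rewrite !mnmE; case: asboolP => //= Qi; case: asboolP => //= Qj.
    by case: nex; exists i, j.
  rewrite mpolyXE_id; apply: (big_ind (fun f => ~ Q f)) => // [u v nu nv uv | i _].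
    have := QM u v; rewrite memE => /(_ uv) /orP.
    by rewrite !memE => -[].
  by rewrite mnmE; case: asboolP.
exists i, j; split=> //; apply: ideal_gen_ind => // [f g Qf Qg|c g gE].
  by have := QD 1 f g; rewrite !memE mul1r; exact.
have := QD c g 0; rewrite !memE addr0; apply=> //.
by case: gE => ->.
Qed.

Lemma cover_ideal_sub_edge i j : e i j -> cover_ideal K e `<=` edge_prime K i j.
Proof. by move=> eij f /(_ i j eij). Qed.

(** A minimal prime contains an edge prime, hence equals it.  Conversely, an edge
    prime is minimal because the variables in it are just the two ends of the edge,
    so that the primes of two different edges are incomparable. *)
Lemma minimal_primes_cover (P : set {mpoly K[n]}) :
  minimal_primes (cover_ideal K e) P <-> exists i j, e i j /\ P = edge_prime K i j.
Proof.
split=> [[primeP JP minP] | [i [j [eij ->]]]].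
  have [i [j [eij sP]]] := prime_contains_edge primeP JP.
  exists i, j; split=> //; apply/esym; apply: minP sP.
    exact: edge_prime_prime.
  exact: cover_ideal_sub_edge.
split; [exact: edge_prime_prime | exact: cover_ideal_sub_edge |].
move=> Q primeQ JQ sQ; have [a [b [eab sab]]] := prime_contains_edge primeQ JQ.
rewrite eqEsubset; split=> //; apply: (subset_trans _ sab).
have mem l : l = a \/ l = b -> l = i \/ l = j.
  move=> lE; have : edge_prime K i j 'X_l.
    by apply/sQ/sab/ideal_gen_mem; case: lE => ->; [left | right].
  rewrite edge_primeE => /supp_inX; rewrite /edge_ge !mnm1E.
  by case: eqP => [->|_]; [left | case: eqP => [->|//]; right].
have ab : a <> b by move=> E; rewrite E e_irr in eab.
have sub l : l = i \/ l = j -> l = a \/ l = b.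
  have := mem a (or_introl erefl); have := mem b (or_intror erefl).
  move=> [] Eb [] Ea; subst; tauto.
move=> f; apply: ideal_gen_ind => [||c g gE]; [exact: ideal_gen0 |
  by move=> *; exact: ideal_genD | apply/ideal_genM/ideal_gen_mem].
case: gE => ->.
  by case: (sub i) => [|->|->]; [left | left | right].
by case: (sub j) => [|->|->]; [right | left | right].
Qed.

Lemma ideal_pow_cover_sub k i j : e i j ->
  ideal_pow (cover_ideal K e) k `<=` supp_in K (edge_ge i j k).
Proof.
move=> eij f; apply: ideal_gen_ind => [|f1 f2|c g [G [JG ->]]];
  [exact: supp_in0 | exact: supp_inD |].
apply: (@supp_inM _ _ predT (edge_ge i j k)) => // [m1 m2 _|].
  rewrite /edge_ge !mnmDE; lia.
elim: k G JG => [|k IH] G JG.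
  by rewrite big_ord0 => m _.
rewrite big_ord_recl.
apply: (@supp_inM _ _ (edge_ge i j 1) (edge_ge i j k)).
- by move=> m1 m2; rewrite /edge_ge !mnmDE; lia.
- by rewrite -edge_primeE; exact: JG.
- exact: IH.
Qed.

(** The product of all variables other than ['X_i] and ['X_j].  It lies outside the
    prime of the edge, and it becomes a vertex cover as soon as one end of the
    edge is added. *)
Definition off_edge i j : 'X_{1..n} :=
  [multinom ((l != i) && (l != j) : nat) | l < n].

Lemma cover_ideal_off_edge i j l : l = i \/ l = j -> e i j ->
  cover_ideal K e 'X_[off_edge i j + U_(l)].
Proof.
move=> lE eij; rewrite cover_idealE; apply/supp_inX/k_coverP => a b eab.
have ab : a != b by apply/eqP => E; rewrite E e_irr in eab.
have ij : i != j by apply/eqP => E; rewrite E e_irr in eij.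
rewrite !mnmDE !mnm1E !mnmE.
case: lE => ->; move: ab ij; do !case: eqVneq => //= *; subst; lia || congruence.
Qed.

(** Distribute [k] of the factors ['X_i] and ['X_j] of ['X_[m]] over the [k] copies of
    ['X_[off_edge i j]]: each copy becomes a vertex cover. *)
Lemma ideal_pow_off_edge k i j m : e i j -> (k <= m i + m j)%N ->
  ideal_pow (cover_ideal K e) k ('X_[off_edge i j *+ k] * 'X_[m]).
Proof.
move=> eij kij.
have ij : i != j by apply/eqP => E; rewrite E e_irr in eij.
(* the first m i copies receive i, the others j *)
pose G (t : 'I_k) := if (t < m i)%N then i else j.
pose p := (\sum_(t < k) U_(G t))%MM.
have pl l : p l = (\sum_(t < k) (G t == l))%N.
  by rewrite mnm_sumE; apply: eq_bigr => t _; rewrite mnm1E.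
have pm : (p <= m)%MM.
  apply/mnm_lepP => l; rewrite pl /G.
  have E q : (\sum_(t < q) (t < m i))%N = minn (m i) q.
    by elim: q => [|q IH]; rewrite ?big_ord0 ?minn0 // big_ord_recr /= IH; lia.
  have E' q : (\sum_(t < q) (~~ (t < m i)%N))%N = (q - m i)%N.
    by elim: q => [|q IH]; rewrite ?big_ord0 ?sub0n // big_ord_recr /= IH; lia.
  case: (eqVneq l i) => [->|li].
    rewrite (eq_bigr (fun t : 'I_k => nat_of_bool (t < m i)%N)).
      by rewrite E geq_minl.
    by move=> t _; case: ifP => _; rewrite ?eqxx // eq_sym (negbTE ij).
  case: (eqVneq l j) => [->|lj].
    rewrite (eq_bigr (fun t : 'I_k => nat_of_bool (~~ (t < m i)%N))).
      by rewrite E'; lia.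
    by move=> t _; case: ifP => _; rewrite ?eqxx // (negbTE ij).
  rewrite big1 // => t _.
  by case: ifP => _; rewrite eq_sym ?(negbTE li) ?(negbTE lj).
rewrite -(submK pm) mpolyXD mulrCA; apply/ideal_genM/ideal_gen_mem.
exists (fun t => 'X_[off_edge i j + U_(G t)]); split.
  by move=> t; apply: cover_ideal_off_edge => //; rewrite /G; case: ifP; [left|right].
rewrite -mpolyXD /p -(big_morph _ (@mpolyXD n K) (@mpolyX0 n K)); congr 'X_[_].
apply/mnmP => l; rewrite mnmDE !mnm_sumE mulmnE.
under [RHS]eq_bigr do rewrite mnmDE.
by rewrite big_split /= sum_nat_const card_ord mulnC.
Qed.

Lemma symbolic_power_coverE k :
  symbolic_power (cover_ideal K e) k = supp_in K (k_cover k).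
Proof.
rewrite predeqE => f; split=> [h | h P].
  move=> m mf; apply/k_coverP => i j eij.
  have [|s [sP sf]] := h (edge_prime K i j).
    by apply/minimal_primes_cover; exists i, j.
  exact: edge_ge_cancel sP (ideal_pow_cover_sub eij sf) m mf.
case/minimal_primes_cover => i [j [eij ->]].
exists 'X_[off_edge i j *+ k]; split.
  rewrite edge_primeE => /supp_inX.
  by rewrite /edge_ge !mulmnE !mnmE !eqxx andbF !mul0n.
rewrite [f]mpolyE mulr_sumr big_seq.
apply: big_ind => [|g g'|m /h /k_coverP mc]; [exact: ideal_gen0 | exact: ideal_genD |].
rewrite -mul_mpolyC mulrCA; apply: ideal_genM.
by apply: ideal_pow_off_edge => //; exact: mc.
Qed.

End SymbolicPowers.

(** * The degree of the symbolic powers *)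

Section Degree.
Variables (n : nat) (e : rel 'I_n).
Hypotheses (e_sym : symmetric e) (e_irr : irreflexive e).
Implicit Types (m : 'X_{1..n}) (i j : 'I_n).

Lemma k_cover_up k : up_closed (k_cover e k).
Proof.
move=> m m' /k_coverP mc /mnm_lepP le; apply/k_coverP => i j /mc h.
exact: leq_trans h (leq_add (le i) (le j)).
Qed.

Lemma minimal_k_coverP k m : minimal_in (k_cover e k) m <-> tight_cover e k m.
Proof.
split=> [[/k_coverP mc minm] | [mc mt]].
  split=> // i mi; apply: contrapT => nex.
  have le : (m - U_(i) <= m)%MM by exact: lem_subr.
  suff cov : k_cover e k (m - U_(i))%MM.
    have /(congr1 (fun q : 'X_{1..n} => q i)) := minm _ cov le.
    by rewrite mnmBE mnm1E eqxx; lia.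
  have slack j : e i j -> k < m i + m j.
    move=> eij; rewrite ltn_neqAle mc // andbT; apply/eqP => E.
    by apply: nex; exists j.
  apply/k_coverP => a b eab; rewrite !mnmBE !mnm1E.
  case: (eqVneq i a) => [Ea|_]; case: (eqVneq i b) => [Eb|_].
  - by rewrite -Ea -Eb e_irr in eab.
  - by rewrite -Ea in eab *; have := slack b eab; lia.
  - by rewrite -Eb e_sym in eab *; have := slack a eab; lia.
  - by rewrite !subn0; exact: mc.
split; first exact/k_coverP.
move=> m' /k_coverP mc' /mnm_lepP le; apply/mnmP => i; apply/eqP.
rewrite eqn_leq le leqNgt; apply/negP => lti.
have [|j eij] := mt i; first exact: leq_ltn_trans lti.
by have := mc' i j eij; have := le j; lia.
Qed.

Lemma deg_k_covers (K : fieldType) k : unmixed e \/ claw_free e ->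
  deg (supp_in K (k_cover e k)) = k * max_cover_size e.
Proof.
move=> hG; apply: deg_supp_in; first exact: k_cover_up.
  move=> m /minimal_k_coverP mt; rewrite mdegE.
  exact: tight_cover_bound mt.
have [A mA cA] := max_cover_size_attained e_sym e_irr.
exists [multinom k * (i \notin A) | i < n].
  apply/minimal_k_coverP.
  have [cov tight] := tight_cover_max e_sym e_irr k mA.
  split=> [i j /cov | i]; rewrite !mnmE // => /tight[j eij E].
  by exists j; rewrite // mnmE.
rewrite mdegE -cA -sum1_card big_distrr /= [RHS]big_mkcond /=.
apply: eq_bigr => i _; rewrite mnmE finset.in_setC.
by case: (i \in A); rewrite ?muln0 ?muln1.
Qed.

End Degree.

Theorem corollary5p3 (n : nat) (K : fieldType) (e : rel 'I_n)
    (e_sym : symmetric e) (e_irr : irreflexive e)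
    (hG : unmixed e \/ claw_free e) :
  (forall k : nat, 1 <= k ->
     deg (symbolic_power (cover_ideal K e) k) = k * deg (cover_ideal K e))
  /\ (exists a : nat, forall k : nat, 1 <= k ->
        deg (symbolic_power (cover_ideal K e) k) = a * k).
Proof.
have degk k : deg (symbolic_power (cover_ideal K e) k) = k * max_cover_size e.
  by rewrite symbolic_power_coverE // deg_k_covers.
have deg1 : deg (cover_ideal K e) = max_cover_size e.
  by rewrite cover_idealE deg_k_covers // mul1n.
split=> [k _|]; first by rewrite degk deg1.
by exists (max_cover_size e) => k _; rewrite degk mulnC.
Qed.
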